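(* Let $R$ be a $\phi$-ring. Then $R$ is nonnil-Noetherian if and only if every nonnil-FP-injective $R$-module is nonnil-injective.
   Context: All rings are commutative with identity and all modules are unitary. $\mathrm{Nil}(R)$ denotes the set of nilpotent elements of $R$. $R$ is a $\phi$-ring if $\mathrm{Nil}(R)$ is a divided prime ideal, i.e. $\mathrm{Nil}(R)$ is a prime ideal and $\mathrm{Nil}(R)\subsetneq (x)$ for every $x\in R\setminus \mathrm{Nil}(R)$. An ideal of $R$ is nonnil if it contains a non-nilpotent element. A $\phi$-ring is nonnil-Noetherian if each of its nonnil ideals is finitely generated. An $R$-module $T$ is $\phi$-torsion if for every $x\in T$ there is a nonnil ideal $I$ of $R$ with $Ix=0$. An $R$-module $M$ is nonnil-injective if $\operatorname{Ext}^1_R(T,M)=0$ for every $\phi$-torsion $R$-module $T$; it is nonnil-FP-injective if $\operatorname{Ext}^1_R(T,M)=0$ for every finitely presented $\phi$-torsion $R$-module $T$. *)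

(* Defs.v *)
From HB Require Import structures.
From mathcomp Require Import all_boot all_order all_algebra.
From mathcomp Require Import boolp classical_sets.
From mathcomp Require freeg.

Set Implicit Arguments.
Unset Strict Implicit.
Unset Printing Implicit Defensive.

Import GRing.Theory.
Local Open Scope classical_set_scope.
Local Open Scope ring_scope.

(* Closure under opposites is the case [a = -1] of closure under scaling. The
   library's [idealr_closed] is not used: it forces ideals to be proper. *)
Definition is_ideal (R : comNzRingType) (I : set R) : Prop :=
  [/\ I 0, forall x y, I x -> I y -> I (x + y) & forall a x, I x -> I (a * x)].

Definition is_prime_ideal (R : comNzRingType) (P : set R) : Prop :=
  [/\ is_ideal P, ~ P 1 & forall x y, P (x * y) -> P x \/ P y].

Definition generated_ideal (R : comNzRingType) (n : nat) (a : 'I_n -> R) : set R :=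
  [set x | exists c : 'I_n -> R, x = \sum_(i < n) c i * a i].

Definition principal_ideal (R : comNzRingType) (x : R) : set R :=
  [set y | exists a : R, y = a * x].

Definition fin_gen_ideal (R : comNzRingType) (I : set R) : Prop :=
  exists (n : nat) (a : 'I_n -> R), I = generated_ideal a.

Definition Nil (R : comNzRingType) : set R :=
  [set x | exists n : nat, x ^+ n = 0].

(* [`<`] is strict inclusion. *)
Definition phi_ring (R : comNzRingType) : Prop :=
  is_prime_ideal (@Nil R) /\
  forall x : R, ~ Nil x -> @Nil R `<` principal_ideal x.

Definition nonnil_ideal (R : comNzRingType) (I : set R) : Prop :=
  is_ideal I /\ exists x, I x /\ ~ Nil x.

(* Meant for phi-rings. *)
Definition nonnil_Noetherian (R : comNzRingType) : Prop :=
  forall I : set R, nonnil_ideal I -> fin_gen_ideal I.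

Definition phi_torsion (R : comNzRingType) (T : lmodType R) : Prop :=
  forall x : T, exists I : set R,
    nonnil_ideal I /\ forall a, I a -> a *: x = 0.

Definition lin_surjective (R : comNzRingType) (U V : lmodType R)
    (f : {linear U -> V}) : Prop :=
  range f = [set: V].

(* Exactness of U --f--> V --g--> W at V. *)
Definition lin_exact (R : comNzRingType) (U V W : lmodType R)
    (f : {linear U -> V}) (g : {linear V -> W}) : Prop :=
  range f = [set v | g v = 0].

Definition finitely_presented (R : comNzRingType) (T : lmodType R) : Prop :=
  exists (m n : nat) (f : {linear 'rV[R]_m -> 'rV[R]_n})
         (g : {linear 'rV[R]_n -> T}),
    lin_exact f g /\ lin_surjective g.

Definition projective (R : comNzRingType) (P : lmodType R) : Prop :=
  forall (A B : lmodType R) (p : {linear A -> B}) (f : {linear P -> B}),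
    lin_surjective p -> exists g : {linear P -> A}, forall x, p (g x) = f x.

(* ... -> res_obj 2 -> res_obj 1 -> res_obj 0 -> T -> 0 *)
Record projective_resolution (R : comNzRingType) (T : lmodType R) :=
  ProjectiveResolution {
    res_obj : nat -> lmodType R;
    res_diff : forall n : nat, {linear res_obj n.+1 -> res_obj n};
    res_aug : {linear res_obj 0%N -> T};
    res_projective : forall n : nat, projective (res_obj n);
    res_exact : forall n : nat, lin_exact (res_diff n.+1) (res_diff n);
    res_exact0 : lin_exact (res_diff 0%N) res_aug;
    res_aug_surj : lin_surjective res_aug }.

(* Kernel of Hom(P_1, M) -> Hom(P_2, M). *)
Definition cocycles1 (R : comNzRingType) (T : lmodType R)
    (P : projective_resolution T) (M : lmodType R) :
    set {linear res_obj P 1%N -> M} :=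
  [set f | forall z : res_obj P 2%N, f (res_diff P 1%N z) = 0].

(* Image of Hom(P_0, M) -> Hom(P_1, M). *)
Definition coboundaries1 (R : comNzRingType) (T : lmodType R)
    (P : projective_resolution T) (M : lmodType R) :
    set {linear res_obj P 1%N -> M} :=
  [set f | exists g : {linear res_obj P 0%N -> M},
             forall y : res_obj P 1%N, f y = g (res_diff P 0%N y)].

(* Ext^1_R(T, M) = H^1(Hom(P, M)) for P a projective resolution of T, and it is
   zero when cocycles are coboundaries. The choice of P is immaterial, and
   [projective_resolution_exists] below shows that there is one. *)
Definition Ext1_eq0 (R : comNzRingType) (T M : lmodType R) : Prop :=
  forall P : projective_resolution T, @cocycles1 R T P M `<=` @coboundaries1 R T P M.

Definition nonnil_injective (R : comNzRingType) (M : lmodType R) : Prop :=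
  forall T : lmodType R, phi_torsion T -> Ext1_eq0 T M.

Definition nonnil_FP_injective (R : comNzRingType) (M : lmodType R) : Prop :=
  forall T : lmodType R,
    finitely_presented T -> phi_torsion T -> Ext1_eq0 T M.

Section Kernel.
Variables (R : comNzRingType) (U V : lmodType R) (f : {linear U -> V}).

Definition in_ker : {pred U} := [pred x | f x == 0].

Fact in_ker_submod_closed : GRing.submod_closed in_ker.
Proof.
split=> [|a x y]; rewrite !inE ?linear0 // => /eqP fx0 /eqP fy0.
by rewrite linearP fx0 fy0 scaler0 addr0.
Qed.

HB.instance Definition _ :=
  GRing.isSubmodClosed.Build R U in_ker
    (GRing.submod_closed_semi in_ker_submod_closed).

Definition ker_mod := {x : U | x \in in_ker}.

HB.instance Definition _ := SubChoice.on ker_mod.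
HB.instance Definition _ := [SubChoice_isSubLmodule of ker_mod by <:].

Definition ker_incl : ker_mod -> U := val.

Fact ker_incl_linear : linear ker_incl.
Proof. by move=> a x y; rewrite /ker_incl linearP. Qed.

HB.instance Definition _ :=
  GRing.isLinear.Build R ker_mod U *:%R ker_incl ker_incl_linear.

End Kernel.

Section FreeCover.
Import freeg.
Variables (R : comNzRingType) (T : lmodType R).

Fact fglift_linear (M : lmodType R) (h : T -> M) :
  linear (fglift h : {freeg T / R} -> M).
Proof.
have addh : zmod_morphism (fglift h : {freeg T / R} -> M).
  exact: lift_is_additive.
pose aM := GRing.isZmodMorphism.Build {freeg T / R} M (fglift h) addh.
pose F : {additive {freeg T / R} -> M} := HB.pack (fglift h) aM.
move=> c D E; rewrite -[fglift h]/(F : _ -> _) raddfD; congr (_ + _).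
rewrite -[c *: D]/(fgscale c D) /fgscale raddf_sum -[in RHS](freeg_sumE D).
rewrite raddf_sum scaler_sumr; apply: eq_bigr => x _.
by rewrite /= !liftU scalerA.
Qed.

Definition free_lift (M : lmodType R) (h : T -> M) : {freeg T / R} -> M :=
  fglift h.

HB.instance Definition _ (M : lmodType R) (h : T -> M) :=
  GRing.isLinear.Build R {freeg T / R} M *:%R (@free_lift M h)
    (@fglift_linear M h).

Definition free_mod : lmodType R := {freeg T / R}.

Definition free_cover : {linear free_mod -> T} := @free_lift T id.

Lemma free_coverU (x : T) : free_cover << x >> = x.
Proof. by rewrite /= /free_lift liftU scale1r. Qed.

Lemma free_cover_surjective : lin_surjective free_cover.
Proof.
by apply/seteqP; split=> // x _; exists << x >>; rewrite ?free_coverU.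
Qed.

Lemma free_projective : projective free_mod.
Proof.
move=> A B p f p_surj.
have /choice[h hP] (x : T) : exists a, p a = f << x >>.
  have : range p (f << x >>) by rewrite p_surj.
  by case=> a _ <-; exists a.
exists (@free_lift A h) => D; rewrite -(freeg_sumE D) !raddf_sum.
apply: eq_bigr => x _ /=; rewrite /free_lift liftU linearZ hP -linearZ.
congr (f _); apply/eqP/freeg_eqP => y.
by rewrite coeffZ !coeffU mul1r.
Qed.

End FreeCover.

Section FreeResolution.
Variables (R : comNzRingType) (T : lmodType R).

Fixpoint syzygy (n : nat) : lmodType R :=
  if n is n'.+1 then ker_mod (free_cover (syzygy n')) else T.

Definition free_res_diff (n : nat) :
    {linear free_mod (syzygy n.+1) -> free_mod (syzygy n)} :=
  @ker_incl R (free_mod (syzygy n)) (syzygy n) (free_cover (syzygy n))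
    \o free_cover (syzygy n.+1).

Fact free_res_diff_range (n : nat) :
  range (free_res_diff n) = [set v | free_cover (syzygy n) v = 0].
Proof.
apply/seteqP; split=> [_ [u _ <-]|v /= v0].
  by rewrite /=; apply/eqP; exact: (valP (free_cover (syzygy n.+1) u)).
have vK : v \in in_ker (free_cover (syzygy n)) by rewrite inE; apply/eqP.
have : range (free_cover (syzygy n.+1)) (exist _ v vK : syzygy n.+1).
  by rewrite free_cover_surjective.
by case=> u _ eu; exists u => //=; rewrite eu.
Qed.

Fact free_res_exact (n : nat) :
  lin_exact (free_res_diff n.+1) (free_res_diff n).
Proof.
rewrite /lin_exact free_res_diff_range; apply/seteqP.
split=> v /= v0; first by rewrite v0.
exact: val_inj.
Qed.

Lemma projective_resolution_exists : inhabited (projective_resolution T).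
Proof.
constructor; apply: (@ProjectiveResolution R T (fun n => free_mod (syzygy n))
  free_res_diff (free_cover T)) => [n|||].
- exact: free_projective.
- exact: free_res_exact.
- exact: (free_res_diff_range 0).
- exact: free_cover_surjective.
Qed.

End FreeResolution.

(* Main.v *)
(* A nonnil-FP-injective module over a nonnil-Noetherian ring extends maps from
   nonnil ideals, and Baer's argument then extends maps from the kernel of any
   presentation of a phi-torsion module, because the colon ideals met on the way
   contain annihilators and so are nonnil. Conversely, following Bass, let
   [D = Q/Z] and let [M] be the direct sum of countably many copies of
   [Hom_Z(R, D)], which is FP-injective. A nonnil ideal that is not finitely
   generated contains a strictly increasing chain of nonnil ideals [J n];
   additive maps [R -> D] killing [J n] but not [J n.+1] combine into a map from
   the union of the chain to [M] that has no extension to [R], so [M] is not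
   nonnil-injective. *)
From HB Require Import structures.
From mathcomp Require Import all_boot all_order all_algebra.
From mathcomp Require Import ring_quotient boolp classical_sets functions.
Require Import Defs.

Set Implicit Arguments.
Unset Strict Implicit.
Unset Printing Implicit Defensive.

Import Order.TTheory GRing.Theory Num.Theory.
Local Open Scope classical_set_scope.
Local Open Scope ring_scope.
Local Open Scope quotient_scope.

(** * Submodules and quotient modules *)

Definition is_submod (S : comNzRingType) (V : lmodType S) (N : set V) : Prop :=
  N 0 /\ forall a x y, N x -> N y -> N (a *: x + y).

Lemma linear_pack (S : comNzRingType) (U V : lmodType S) (h : U -> V) :
  linear h -> exists f : {linear U -> V}, f =1 h.
Proof.
move=> lin_h; pose mix := GRing.isLinear.Build S U V *:%R h lin_h.
by exists (HB.pack h mix : {linear U -> V}).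
Qed.

Section Quotient.
Variables (S : comNzRingType) (V : lmodType S) (N : set V).
Hypothesis subN : is_submod N.

(** The proof is an argument so that the closure instance, which depends on it, can attach to
    [in_submod subN]. *)
Definition in_submod of is_submod N : {pred V} := fun x => `[< N x >].
Let I := in_submod subN.

Let IE x : (x \in I) = `[< N x >]. Proof. by []. Qed.

Fact in_submod_closed : GRing.submod_closed I.
Proof.
case: subN => N0 NP; split=> [|a x y]; first by rewrite IE; apply/asboolP.
by rewrite !IE => /asboolP Nx /asboolP Ny; apply/asboolP; exact: NP.
Qed.

HB.instance Definition _ :=
  GRing.isSubmodClosed.Build S V I (GRing.submod_closed_semi in_submod_closed).

Definition quot_mod := Quotient.quot I.

HB.instance Definition _ := GRing.Zmodule.on quot_mod.

Let pi (x : V) : quot_mod := \pi_(Quotient.quot I) x.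

Let pi_eq x y : pi x = pi y <-> N (x - y).
Proof.
split=> [/eqP|Nxy]; first by rewrite -Quotient.idealrBE => /asboolP.
by apply/eqP; rewrite -Quotient.idealrBE; apply/asboolP.
Qed.

Let piD x y : pi (x + y) = pi x + pi y.
Proof. exact: (raddfD \pi_(Quotient.quot I)). Qed.

Definition quot_scale (a : S) (x : quot_mod) : quot_mod := pi (a *: repr x).

Let pi_scale a x : quot_scale a (pi x) = pi (a *: x).
Proof.
case: subN => N0 NP; apply/pi_eq; rewrite -scalerBr -[_ *: _]addr0.
by apply: NP => //; apply/pi_eq; exact: reprK.
Qed.

Let piK (x : quot_mod) : pi (repr x) = x. Proof. exact: reprK. Qed.

Fact quot_scalerA a b x :
  quot_scale a (quot_scale b x) = quot_scale (a * b) x.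
Proof. by rewrite -[x]piK !pi_scale scalerA. Qed.

Fact quot_scale1r : left_id 1 quot_scale.
Proof. by move=> x; rewrite -[x]piK pi_scale scale1r. Qed.

Fact quot_scalerDr : right_distributive quot_scale +%R.
Proof.
by move=> a x y; rewrite -[x]piK -[y]piK -piD !pi_scale -piD scalerDr.
Qed.

Fact quot_scalerDl x : {morph quot_scale^~ x : a b / a + b}.
Proof. by move=> a b; rewrite -[x]piK !pi_scale -piD scalerDl. Qed.

HB.instance Definition _ := GRing.Zmodule_isLmodule.Build S quot_mod
  quot_scalerA quot_scale1r quot_scalerDr quot_scalerDl.

Lemma quotient_exists : exists (Q : lmodType S) (p : {linear V -> Q}),
  lin_surjective p /\ forall x, p x = 0 <-> N x.
Proof.
have lin_pi : linear pi by move=> a x y; rewrite piD -pi_scale.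
have [p pE] := linear_pack lin_pi; exists quot_mod, p; split=> [|x].
  by apply/seteqP; split=> // x _; exists (repr x) => //; rewrite pE piK.
have p0 : pi 0 = 0 by rewrite -(pE 0) raddf0.
by rewrite pE -p0 pi_eq subr0.
Qed.

End Quotient.

(** * Baer's argument for extending linear maps *)

(** A map on [I] is encoded as a total function [h] whose values off [I] are irrelevant, and a
    linear map on all of [S] as an element [m], its value at [1]. *)
Definition extends_ideal (S : comNzRingType) (I : set S)
    (M : lmodType S) : Prop :=
  forall h : S -> M,
    (forall a x y, I x -> I y -> h (a * x + y) = a *: h x + h y) ->
    exists m, forall a, I a -> h a = a *: m.

Section Baer.
Variables (S : comNzRingType) (A M : lmodType S).

(** For a submodule [G], this makes [G] the graph of a linear map defined on part of [A]. *)
Let functional (G : set (A * M)) := forall m, G (0, m) -> m = 0.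

Let functionalP G x m1 m2 : is_submod G -> functional G ->
  G (x, m1) -> G (x, m2) -> m1 = m2.
Proof.
move=> [_ GP] fG G1 G2; apply/eqP; rewrite -subr_eq0 addrC -scaleN1r.
apply/eqP/fG.
by have := GP (-1) _ _ G2 G1; congr (G (_, _)); rewrite /= scaleN1r addNr.
Qed.

(* Baer's argument: a maximal functional submodule of [A * M] containing [G]
   is total, since otherwise one more element can be adjoined to its domain. *)
Lemma linear_graph_extends (G : set (A * M)) :
  is_submod G -> (forall m, G (0, m) -> m = 0) ->
  (forall (x : A) (I : set S), is_ideal I ->
     [set a | exists m, G (a *: x, m)] `<=` I -> extends_ideal I M) ->
  exists f : {linear A -> M}, forall x m, G (x, m) -> f x = m.
Proof.
move=> subG fG extG.
(* [set0] is allowed because the empty chain must have an upper bound. *)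
pose P X := X = set0 \/ [/\ is_submod X, functional X & G `<=` X].
have [|X [PX maxX]] := @Zorn_bigcup _ P.
  move=> F FP totF; have [F0|] := pselect (F `<=` [set set0]).
    by left; apply: bigcup0 => X /F0.
  move=> /existsNP[X0 /not_implyP[FX0 nX0]].
  have FX X : F X -> X !=set0 -> [/\ is_submod X, functional X & G `<=` X].
    by move=> /FP[->|//] [].
  have X0n0 : X0 !=set0 by apply/set0P/eqP.
  have [[X00 _] _ GX0] := FX _ FX0 X0n0.
  right; split=> [|m [X FXX Xm]|u Gu]; last by exists X0 => //; exact: GX0.
    split=> [|a u v [X FXX Xu] [Y FYY Yv]]; first by exists X0.
    have [XY|YX] := totF _ _ FXX FYY.
      exists Y => //; have [[_ YP] _ _] := FX _ FYY (ex_intro _ _ Yv).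
      by apply: YP => //; exact: XY.
    exists X => //; have [[_ XP] _ _] := FX _ FXX (ex_intro _ _ Xu).
    by apply: XP => //; exact: YX.
  have [_ fX _] := FX _ FXX (ex_intro _ _ Xm).
  exact: fX.
have [X0|[subX fX GX]] := PX.
  exfalso; apply: (maxX G); last by right; split.
  by rewrite X0; split => //; move=> /(_ 0 (proj1 subG)).
have total x : exists m, X (x, m).
  (* The scalars carrying [x] into the domain of [X]. As [G] lies in [X], they include those
     carrying [x] into the domain of [G], so [extG] applies and yields a value [m0] for [x]. *)
  pose I : set S := [set a | exists m, X (a *: x, m)].
  have [X0 XP] := subX.
  have /choice[k kP] a : exists m, I a -> X (a *: x, m).
    have [[m Xm]|nIa] := pselect (I a); first by exists m.
    by exists 0 => /nIa.
  have idI : is_ideal I.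
    split=> [|a b [m Xm] [n Xn]|a b [m Xm]]; first by exists 0; rewrite scale0r.
      by exists (m + n); have := XP 1 _ _ Xm Xn; congr (X (_, _)) => /=;
        rewrite ?scale1r ?scalerDl.
    exists (a *: m); have := XP a _ _ Xm X0.
    by congr (X (_, _)); rewrite /= ?addr0 ?scalerA.
  have [|a b c Ib Ic|m0 m0P] := extG x I idI _ k.
  - by move=> a [m /GX]; exists m.
  - have Xabc : X ((a * b + c) *: x, a *: k b + k c).
      by rewrite scalerDl -scalerA; exact: XP (kP _ Ib) (kP _ Ic).
    have Iabc : I (a * b + c) by exists (a *: k b + k c).
    exact: functionalP subX fX (kP _ Iabc) Xabc.
  pose Y : set (A * M) := [set u | exists y m a,
    X (y, m) /\ u = (y + a *: x, m + a *: m0)].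
  have XY : X `<=` Y.
    by move=> [y m] Xym; exists y, m, 0; rewrite !scale0r !addr0.
  have PY : P Y.
    right; split.
    - split; first exact: XY.
      move=> a _ _ [y [m [b [Xym ->]]]] [z [n [c [Xzn ->]]]].
      exists (a *: y + z), (a *: m + n), (a * b + c).
      split; first exact: (XP a _ _ Xym Xzn).
      by congr (_, _) => /=; rewrite scalerDr scalerDl scalerA addrACA.
    (* The adjoined value is consistent: [y + a *: x = 0] puts [a *: x] in the domain of [X] with
       value [- n], and [m0P] identifies that value with [a *: m0]. *)
    - move=> m [y [n [a [Xyn [yx ->]]]]].
      have Xax : X (a *: x, - n).
        have := XP (-1) _ _ Xyn X0.
        congr (X (_, _)); rewrite /= addr0 scaleN1r //.
        by apply/eqP; rewrite eq_sym -subr_eq0 opprK addrC -yx.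
      have Ia : I a by exists (- n).
      rewrite -m0P //; apply/eqP; rewrite addr_eq0 -eqr_oppLR; apply/eqP.
      exact: functionalP subX fX Xax (kP _ Ia).
    - exact: subset_trans GX XY.
  have YX : Y `<=` X by apply: contrapT => nYX; exact: (maxX Y).
  exists m0; apply: YX; exists 0, 0, 1; split=> //.
  by rewrite !scale1r !add0r.
have /choice[h hP] := total.
have [|f fE] := @linear_pack _ _ _ h.
  move=> a x y; apply: (functionalP subX fX (hP _)).
  exact: (proj2 subX a _ _ (hP x) (hP y)).
exists f => x m /GX Gxm; rewrite fE; exact: functionalP subX fX (hP x) Gxm.
Qed.

End Baer.

(** * Vanishing of Ext through one projective presentation *)

Section Extensions.
Variable S : comNzRingType.

Definition linear_on_kernel (T A M : lmodType S) (p : {linear A -> T})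
    (h : A -> M) : Prop :=
  forall a x y, p x = 0 -> p y = 0 -> h (a *: x + y) = a *: h x + h y.

Section LinearOnKernel.
Variables (T A M : lmodType S) (p : {linear A -> T}) (h : A -> M).
Hypothesis h_lin : linear_on_kernel p h.

Lemma linear_on_kernel0 : h 0 = 0.
Proof.
have := h_lin (-1) (linear0 p) (linear0 p).
by rewrite scaler0 addr0 scaleN1r addNr.
Qed.

Lemma linear_on_kernelZ a x : p x = 0 -> h (a *: x) = a *: h x.
Proof.
move=> px; have := h_lin a px (linear0 p).
by rewrite linear_on_kernel0 !addr0.
Qed.

Lemma linear_on_kernelB x y : p x = 0 -> p y = 0 -> h (x - y) = h x - h y.
Proof. by move=> px py; rewrite addrC -scaleN1r h_lin // scaleN1r addrC. Qed.

End LinearOnKernel.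

(** For [p] onto and [A] projective, this is surjectivity of [Hom(A, M) -> Hom(ker p, M)], which by
    the long exact sequence amounts to [Ext^1(T, M) = 0]. *)
Definition extends_kernel (T A M : lmodType S) (p : {linear A -> T}) : Prop :=
  forall h : A -> M, linear_on_kernel p h ->
    exists f : {linear A -> M}, forall x, p x = 0 -> f x = h x.

(** Comparison of presentations as in Schanuel's lemma: lift [p] and [q] through each other to [u]
    and [v], extend [h \o u] to [f] on [A], and return along [v]. *)
Lemma extends_kernel_projective (T A B M : lmodType S)
    (p : {linear A -> T}) (q : {linear B -> T}) :
  projective A -> projective B -> lin_surjective p -> lin_surjective q ->
  extends_kernel M p -> extends_kernel M q.
Proof.
move=> prA prB surp surq extp h h_lin.
have [u uP] := prA _ _ q p surq; have [v vP] := prB _ _ p q surp.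
have [|f fP] := extp (h \o u).
  by move=> a x y px py /=; rewrite linearP h_lin // uP.
have qK x : q (x - u (v x)) = 0 by rewrite linearB /= uP vP subrr.
(* The point [x - u (v x)] always lies in the kernel of [q], so the correction term is linear; on
   that kernel [f (v x)] is [h (u (v x))] and the sum is [h x]. *)
have [|g gE] := @linear_pack _ _ _ (fun x => f (v x) + h (x - u (v x))).
  move=> a x y; rewrite scalerDr addrACA -h_lin //.
  congr (_ + h _); rewrite (linearP v) ?(linearP f) // (linearP u).
  by rewrite opprD addrACA scalerBr.
exists g => x qx; rewrite gE fP ?vP //=.
have quv : q (u (v x)) = 0 by rewrite uP vP.
have := h_lin 1 _ _ (qK x) quv; rewrite !scale1r subrK => ->.
by rewrite addrC.
Qed.

Lemma res_exact0P (T : lmodType S) (P : projective_resolution T) x :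
  res_aug P x = 0 <-> exists y, res_diff P 0 y = x.
Proof.
rewrite -[_ = 0]/([set v | res_aug P v = 0] x) -res_exact0.
by split=> [[y _ <-]|[y <-]]; exists y.
Qed.

Lemma res_exactP (T : lmodType S) (P : projective_resolution T) n x :
  res_diff P n x = 0 <-> exists y, res_diff P n.+1 y = x.
Proof.
rewrite -[_ = 0]/([set v | res_diff P n v = 0] x) -res_exact.
by split=> [[y _ <-]|[y <-]]; exists y.
Qed.

Lemma res_aug_diff (T : lmodType S) (P : projective_resolution T) y :
  res_aug P (res_diff P 0 y) = 0.
Proof. by apply/res_exact0P; exists y. Qed.

Lemma res_diff_diff (T : lmodType S) (P : projective_resolution T) n z :
  res_diff P n (res_diff P n.+1 z) = 0.
Proof. by apply/res_exactP; exists z. Qed.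

(** For a resolution [P], cocycles are the maps on [P_1] that factor through the kernel of
    [res_aug], and coboundaries those whose factor extends to [P_0]. Comparison of presentations
    then trades [res_aug] for [p]. *)
Lemma Ext1_eq0P (T A M : lmodType S) (p : {linear A -> T}) :
  projective A -> lin_surjective p -> Ext1_eq0 T M <-> extends_kernel M p.
Proof.
move=> prA surp; split=> [ext0|extp P f f_cocycle].
  (* [Ext1_eq0] quantifies over all resolutions, so using it takes an actual one. *)
  have [P] := projective_resolution_exists T.
  suff extP : extends_kernel M (res_aug P).
    exact: (extends_kernel_projective (@res_projective _ _ P 0) prA
      (res_aug_surj P) surp extP).
  move=> h h_lin; have [|f fE] := @linear_pack _ _ _ (h \o res_diff P 0).
    by move=> a x y /=; rewrite linearP h_lin // res_aug_diff.
  have [|g gP] := ext0 P f.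
    move=> z; rewrite fE /= res_diff_diff.
    exact: linear_on_kernel0 h_lin.
  by exists g => x /res_exact0P[y <-]; rewrite -gP fE.
have extP : extends_kernel M (res_aug P).
  exact: (extends_kernel_projective prA (@res_projective _ _ P 0)
    surp (res_aug_surj P) extp).
(* [s] picks preimages under [res_diff P 0], with [0] as filler off the kernel of [res_aug]. Two
   preimages differ by a value of [res_diff P 1], which the cocycle [f] kills, so [f \o s] is linear
   on the kernel. *)
have /choice[s sP] (x : res_obj P 0) :
    exists y, res_aug P x = 0 -> res_diff P 0 y = x.
  have [/res_exact0P[y yx]|nx] := pselect (res_aug P x = 0); first by exists y.
  by exists 0.
have fs y : f (s (res_diff P 0 y)) = f y.
  have : res_diff P 0 (y - s (res_diff P 0 y)) = 0.
    by rewrite linearB /= sP ?subrr ?res_aug_diff.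
  move=> /res_exactP[z zE].
  by apply/eqP; rewrite eq_sym -subr_eq0 -linearB -zE f_cocycle.
have [a x y px py|g gP] := extP (f \o s).
  have <- : res_diff P 0 (a *: s x + s y) = a *: x + y by rewrite linearP !sP.
  by rewrite /= fs linearP.
by exists g => y; rewrite gP ?res_aug_diff //= fs.
Qed.

Lemma regular_projective : projective S^o.
Proof.
move=> A B p f surp; have [x _ px] : range p (f 1) by rewrite surp.
have [|g gE] := @linear_pack _ S^o _ (fun a => a *: x).
  by move=> a b c; rewrite scalerDl scalerA.
by exists g => a; rewrite gE linearZ px -linearZ /= [a *: 1]mulr1.
Qed.

Lemma rowv_projective n : projective 'rV[S]_n.
Proof.
move=> A B p f surp.
have /choice[x xP] (i : 'I_n) : exists x, p x = f (delta_mx 0 i).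
  have [x _ px] : range p (f (delta_mx 0 i)) by rewrite surp.
  by exists x.
have [|g gE] := @linear_pack _ 'rV[S]_n _ (fun v => \sum_i v 0 i *: x i).
  move=> a v w; rewrite scaler_sumr -big_split; apply: eq_bigr => i _.
  by rewrite !mxE scalerDl scalerA.
exists g => v; rewrite gE [in RHS](row_sum_delta v) !linear_sum.
by apply: eq_bigr => i _; rewrite !linearZ xP.
Qed.

(** Here [T] is [S/I], and a linear map from [S] is determined by its value at [1]. *)
Lemma Ext1_eq0_ideal (T M : lmodType S) (p : {linear S^o -> T}) (I : set S) :
  lin_surjective p -> (forall x, p x = 0 <-> I x) ->
  Ext1_eq0 T M <-> extends_ideal I M.
Proof.
move=> surp kerp; rewrite (Ext1_eq0P _ regular_projective surp).
split=> ext h h_lin.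
  have [a x y /kerp Ix /kerp Iy|f fP] := ext h; first exact: h_lin.
  exists (f 1) => a /kerp/fP <-.
  by rewrite -linearZ /= [a *: 1]mulr1.
have [a x y /kerp Ix /kerp Iy|m mP] := ext h; first exact: h_lin.
have [|g gE] := @linear_pack _ S^o _ (fun a => a *: m).
  by move=> a b c; rewrite scalerDl scalerA.
by exists g => a /kerp/mP ->.
Qed.

End Extensions.

(** * Divisible abelian groups and characters *)

Section Integers.

Lemma subgroup_submod (V : lmodType int) (N : set V) :
  N 0 -> (forall x y, N x -> N y -> N (x - y)) ->
  is_submod N.
Proof.
move=> N0 NB; have NN x : N x -> N (- x) by rewrite -sub0r; exact: NB.
have ND x y : N x -> N y -> N (x + y).
  by move=> Nx /NN Ny; rewrite -[y]opprK; exact: NB.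
have NM x n : N x -> N (x *+ n).
  by move=> Nx; elim: n => // n IHn; rewrite mulrS; exact: ND.
split=> // a x y Nx Ny; apply: ND => //; rewrite -[a]intz scaler_int.
by case: a => n; [exact: NM | apply: NN; exact: NM].
Qed.

(** Euclidean division by the least positive element of [I]; the zero ideal takes [n = 0]. *)
Lemma int_ideal_principal (I : set int) :
  is_ideal I -> exists n : nat, forall a, I a <-> exists k, a = k * n%:Z.
Proof.
case=> I0 ID IM; have [I00|] := pselect (I `<=` [set 0]).
  exists 0%N => a; split=> [/I00 ->|[k ->]]; last by rewrite mulr0.
  by exists 0; rewrite mul0r.
move=> /existsNP[b /not_implyP[Ib /eqP b0]].
have [|n /andP[n_gt0 /asboolP In] n_min] :=
    @ex_minnP (fun n => (0 < n)%N && `[< I n%:Z >]) _.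
  exists `|b|%N; rewrite absz_gt0 b0; apply/asboolP.
  by rewrite abszEsg; exact: IM.
exists n => a; split=> [Ia|[k ->]]; last exact: IM.
have n0 : n%:Z != 0 by rewrite eqz_nat -lt0n.
have Ir : I (a %% n%:Z)%Z.
  by rewrite /modz addrC -mulNr; apply: ID => //; exact: IM.
have rE : (a %% n%:Z)%Z = `|(a %% n%:Z)%Z|%N by rewrite gez0_abs ?modz_ge0.
have := ltz_mod a n0; rewrite rE [`|n%:Z|]ger0_norm // ltz_nat => r_lt.
exists (a %/ n%:Z)%Z; rewrite {1}(divz_eq a n%:Z) rE.
have [->|r_gt0] := posnP `|(a %% n%:Z)%Z|%N; first by rewrite addr0.
have := n_min `|(a %% n%:Z)%Z|%N; rewrite r_gt0 -rE leqNgt r_lt => /(_ _).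
by rewrite (asboolT Ir) => /(_ isT).
Qed.

Definition divisible (D : zmodType) : Prop :=
  forall (d : D) n, (0 < n)%N -> exists e, e *+ n = d.

(** On the ideal generated by [n > 0], extending [h] amounts to dividing [h n] by [n]. *)
Lemma divisible_extends_ideal (D : zmodType) (I : set int) :
  divisible D -> is_ideal I -> extends_ideal I (zmodule D).
Proof.
move=> divD idI h h_lin; have [I0 _ _] := idI.
have h0 : h 0 = 0.
  have := h_lin (-1) 0 0 I0 I0.
  by rewrite mulr0 addr0 scaleN1r addNr.
have [n In] := int_ideal_principal idI.
have [n0|n_gt0] := posnP n.
  exists 0 => a /In[k ->]; by rewrite n0 mulr0 h0 scaler0.
have [e en] := divD (h n%:Z) n n_gt0.
exists e => _ /In[k ->]; have IIn : I n%:Z by apply/In; exists 1; rewrite mul1r.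
have := h_lin k _ _ IIn I0; rewrite !addr0 h0 addr0 => ->.
by rewrite -scalerA; congr (_ *: _); rewrite scalezrE -pmulrn.
Qed.

(** Divisible groups are injective, by Baer's argument over the integers. *)
Lemma additive_graph_extends (V D : zmodType) (G : set (V * D)) :
  divisible D -> G 0 -> (forall u v, G u -> G v -> G (u - v)) ->
  (forall d, G (0, d) -> d = 0) ->
  exists f : V -> D, {morph f : x y / x + y} /\ forall x d, G (x, d) -> f x = d.
Proof.
move=> divD G0 GB fG.
have [|x I idI _|f fP] :=
    @linear_graph_extends int (zmodule V) (zmodule D) G _ fG.
- exact: subgroup_submod.
- exact: divisible_extends_ideal.
- by exists f; split=> // x y; exact: raddfD.
Qed.

(** Every nontrivial finite cyclic group maps nontrivially to [D]; for divisible [D], this lets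
    additive maps into [D] separate points. *)
Definition cogenerating (D : zmodType) : Prop :=
  forall n, (1 < n)%N -> exists2 c : D, c != 0 & c *+ n = 0.

(** In [Q/Z] the class of [1/n] serves as [c]. *)
Lemma divisible_cogenerator_exists :
  exists D : zmodType, divisible D /\ cogenerating D.
Proof.
have [|D [p [surp kerp]]] :=
    @quotient_exists int (zmodule rat) [set x | exists z : int, x = z%:~R].
  split=> [|a _ _ [y ->] [z ->]]; first by exists 0.
  by exists (a * y + z); rewrite scalezrE -mulrzr mulrC -intrM -intrD.
exists D; split=> [d n n_gt0|n n_gt1].
  have [x _ <-] : range p d by rewrite surp.
  exists (p (x / n%:R)); rewrite -raddfMn -[_ *+ n]mulr_natr divfK //.
  by rewrite pnatr_eq0 -lt0n.
exists (p n%:R^-1).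
  apply/eqP => /kerp[z nz].
  have [n0 n1] : n%:R != 0 :> rat /\ n%:R != 1 :> rat.
    by rewrite pnatr_eq0 pnatr_eq1 -lt0n neq_ltn n_gt1 orbT ltnW.
  have : (n%:R * z%:~R : rat) = 1 by rewrite -nz mulfV.
  rewrite pmulrn -intrM => /eqP; rewrite -[1]/(1%:~R) eqr_int => /eqP nz1.
  have := congr1 absz nz1; rewrite abszM absz_nat => /eqP.
  by rewrite muln_eq1 gtn_eqF.
rewrite -raddfMn; apply/kerp; exists 1.
by rewrite -[_ *+ n]mulr_natr mulVf // pnatr_eq0 -lt0n ltnW.
Qed.

(** The map [y + k x |-> k c] on the subgroup generated by [N] and [x] extends to [V]; it is well
    defined once the order of [x] modulo [N] kills [c]. *)
Lemma separating_character (V D : zmodType) (N : set V) (x : V) :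
  divisible D -> cogenerating D ->
  N 0 -> (forall y z, N y -> N z -> N (y - z)) -> ~ N x ->
  exists f : V -> D, [/\ {morph f : y z / y + z},
    forall y, N y -> f y = 0 & f x <> 0].
Proof.
move=> divD cogD N0 NB nNx.
have [_ NP] := @subgroup_submod (zmodule V) N N0 NB.
have [|n nP] := @int_ideal_principal [set k | N (x *~ k)].
  split=> [|k l Nk Nl|k l Nl] //=.
    by have := NP 1 _ _ Nk Nl; rewrite scale1r mulrzDr.
  by have := NP k _ _ Nl N0; rewrite scalezrE addr0 mulrC mulrzA.
(* [n] is the order of [x] modulo [N], or [0] when that order is infinite and any nonzero [c] will
   do; [n = 1] would put [x] in [N]. *)
have [c c0 cn] : exists2 c : D, c != 0 & c *+ n = 0.
  case: n nP => [|[|n]] nP; last exact: cogD.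
    by have [c c0 _] := cogD 2%N isT; exists c.
  by case: nNx; rewrite -[x]mulr1z; apply/nP; exists 1.
pose G : set (V * D) := [set u | exists y k, N y /\ u = (y + x *~ k, c *~ k)].
have [||d [y [k [Ny [yx ->]]]]|f [fD fG]] := @additive_graph_extends V D G divD.
- by exists 0, 0; rewrite !mulr0z addr0.
- move=> _ _ [y [k [Ny ->]]] [z [l [Nz ->]]]; exists (y - z), (k - l).
  split; first exact: NB.
  by congr (_, _); rewrite /= mulrzBr // opprD addrACA.
- have /nP[l ->] : N (x *~ k).
    have -> : x *~ k = 0 - y by rewrite yx addrC addKr.
    exact: NB.
  by rewrite mulrC mulrzA -pmulrn cn mul0rz.
exists f; split=> // [y Ny|].
  by apply: fG; exists y, 0; rewrite !mulr0z addr0.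
rewrite (fG x c); first exact/eqP.
by exists 0, 1; rewrite !mulr1z add0r.
Qed.

End Integers.

(* The module of eventually zero sequences in [Hom_Z(R, D)], that is, the direct
   sum of countably many copies of the coinduced module [Hom_Z(R, D)]. *)
Section CofreeSum.
Variables (R : comNzRingType) (D : zmodType).

Definition in_cofree_sum : {pred nat -> R -> D} := fun f =>
  `[< (forall n, {morph f n : x y / x + y}) /\
      exists N, forall n, (N <= n)%N -> f n = 0 >].

Let inP f : reflect ((forall n, {morph f n : x y / x + y}) /\
  exists N, forall n, (N <= n)%N -> f n = 0) (f \in in_cofree_sum).
Proof. exact: asboolP. Qed.

Fact in_cofree_sum_zmod_closed : zmod_closed in_cofree_sum.
Proof.
split=> [|f g /inP[fD [N fN]] /inP[gD [P gP]]]; apply/inP; split.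
- by move=> n x y; rewrite addr0.
- by exists 0%N.
- by move=> n x y; rewrite !fctE fD gD opprD addrACA.
exists (maxn N P) => n; rewrite geq_max => /andP[Nn Pn].
by rewrite -[LHS]/(f n - g n) fN // gP // subr0.
Qed.

HB.instance Definition _ := GRing.isZmodClosed.Build (nat -> R -> D)
  in_cofree_sum in_cofree_sum_zmod_closed.

Definition cofree_sum := {f : nat -> R -> D | f \in in_cofree_sum}.

HB.instance Definition _ := SubChoice.on cofree_sum.
HB.instance Definition _ := [SubChoice_isSubZmodule of cofree_sum by <:].

Lemma cofree_sumP (f : cofree_sum) n : {morph val f n : x y / x + y}.
Proof. by have /inP[] := valP f. Qed.

Lemma cofree_sum_eventually0 (f : cofree_sum) :
  exists N, forall n, (N <= n)%N -> val f n = 0.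
Proof. by have /inP[] := valP f. Qed.

Lemma cofree_sum_ex (f : nat -> R -> D) :
  (forall n, {morph f n : x y / x + y}) ->
  (exists N, forall n, (N <= n)%N -> f n = 0) ->
  exists g : cofree_sum, val g = f.
Proof. by move=> fD fN; have /inP fP := conj fD fN; exists (exist _ f fP). Qed.

Fact cofree_scale_subproof (a : R) (f : cofree_sum) :
  (fun n x => val f n (x * a)) \in in_cofree_sum.
Proof.
apply/inP; split=> [n x y|]; first by rewrite mulrDl cofree_sumP.
by have [N fN] := cofree_sum_eventually0 f; exists N => n /fN ->.
Qed.

(** The coinduced action on each [Hom_Z(R, D)]: scalars act on the argument. *)
Definition cofree_scale (a : R) (f : cofree_sum) : cofree_sum :=
  Sub (fun n x => val f n (x * a)) (cofree_scale_subproof a f).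

Fact cofree_scalerA a b f :
  cofree_scale a (cofree_scale b f) = cofree_scale (a * b) f.
Proof. by apply/val_inj/funext => n; apply/funext => x /=; rewrite mulrA. Qed.

Fact cofree_scale1r : left_id 1 cofree_scale.
Proof.
by move=> f; apply/val_inj/funext => n; apply/funext => x /=; rewrite mulr1.
Qed.

Fact cofree_scalerDr : right_distributive cofree_scale +%R.
Proof. by move=> a f g; apply/val_inj. Qed.

Fact cofree_scalerDl f : {morph cofree_scale^~ f : a b / a + b}.
Proof.
move=> a b; apply/val_inj/funext => n; apply/funext => x /=.
by rewrite mulrDr cofree_sumP.
Qed.

HB.instance Definition _ := GRing.Zmodule_isLmodule.Build R cofree_sum
  cofree_scalerA cofree_scale1r cofree_scalerDr cofree_scalerDl.

Lemma cofree_sumDE (f g : cofree_sum) n x :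
  val (f + g) n x = val f n x + val g n x.
Proof. by []. Qed.

Lemma cofree_sumZE a (f : cofree_sum) n x : val (a *: f) n x = val f n (x * a).
Proof. by []. Qed.

(* The image of a finitely generated kernel lies in finitely many summands, and
   each of these is injective because [D] is. *)
Lemma cofree_sum_Ext1_eq0 (T : lmodType R) :
  divisible D -> finitely_presented T -> Ext1_eq0 T cofree_sum.
Proof.
move=> divD [m [n [f [g [exfg surg]]]]].
apply/(Ext1_eq0P _ (@rowv_projective R n) surg) => h h_lin.
have kerP x : g x = 0 <-> exists v, f v = x.
  rewrite -[_ = 0]/([set v | g v = 0] x) -exfg.
  by split=> [[v _ <-]|[v <-]]; exists v.
have gf v : g (f v) = 0 by apply/kerP; exists v.
have [k kE] : exists k : {linear 'rV[R]_m -> cofree_sum}, k =1 h \o f.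
  by apply: linear_pack => a x y /=; rewrite linearP h_lin.
have /choice[B BP] (j : 'I_m) := cofree_sum_eventually0 (k (delta_mx 0 j)).
pose N := \max_j B j.
have k0 v i : (N <= i)%N -> val (k v) i = 0.
  move=> Ni; apply/funext => r.
  rewrite [v]row_sum_delta linear_sum.
  elim/big_rec: _ => [//|j w _ IH].
  rewrite cofree_sumDE IH linearZ cofree_sumZE.
  by rewrite BP ?addr0 // (leq_trans _ Ni) // leq_bigmax.
(* By adjunction, component [i] of [h] amounts to the additive map [x |-> val (h x) i 1] into [D],
   which [H i] extends from the kernel of [g]. Taking [H i = 0] from [N] on keeps the extension in
   the direct sum. *)
have /choice[H HP] (i : nat) : exists H : 'rV[R]_n -> D,
    [/\ {morph H : x y / x + y}, forall x, g x = 0 -> H x = val (h x) i 1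
      & (N <= i)%N -> H = 0].
  have [Ni|Ni] := leqP N i.
    exists 0; split=> // [x y|x /kerP[v <-]]; first by rewrite addr0.
    by have := kE v; rewrite /= => <-; rewrite k0.
  pose G : set ('rV[R]_n * D) := [set u | g u.1 = 0 /\ u.2 = val (h u.1) i 1].
  have [|||H [HD HG]] := @additive_graph_extends _ _ G divD.
  - by split; rewrite ?linear0 ?(linear_on_kernel0 h_lin).
  - move=> [x c] [y d] [/= gx ->] [/= gy ->].
    by split; rewrite /= ?linearB ?gx ?gy ?subr0 ?(linear_on_kernelB h_lin).
  - by move=> d [_ /= ->]; rewrite (linear_on_kernel0 h_lin).
  by exists H; split=> // x gx; apply: HG.
(* The adjunction read backwards turns the additive maps [H i] into one [R]-linear map. *)
have /choice[F0 F0P] x : exists F : cofree_sum, val F = fun i r => H i (r *: x).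
  apply: cofree_sum_ex => [i r s|].
    by have [HD _ _] := HP i; rewrite scalerDl HD.
  by exists N => i Ni; have [_ _ ->] := HP i.
have [|F FE] := @linear_pack _ _ _ F0.
  move=> a x y; apply/val_inj/funext => i; apply/funext => r.
  have [HD _ _] := HP i.
  by rewrite cofree_sumDE cofree_sumZE !F0P scalerDr HD scalerA.
exists F => x gx; rewrite FE; apply/val_inj/funext => i; apply/funext => r.
have [_ Hh _] := HP i.
rewrite F0P Hh; last by rewrite linearZ_LR gx scaler0.
by rewrite (linear_on_kernelZ h_lin) // cofree_sumZE mul1r.
Qed.

End CofreeSum.

(** * Nonnil ideals and the two implications *)

Section Nonnil.
Variable R : comNzRingType.
Implicit Types (I : set R) (M : lmodType R).

Lemma ideal_submod I : is_ideal I -> is_submod (I : set R^o).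
Proof.
by case=> I0 ID IM; split=> // a x y Ix Iy; apply: ID => //; exact: IM.
Qed.

Lemma cyclic_phi_torsion I (T : lmodType R) (p : {linear R^o -> T}) :
  nonnil_ideal I -> lin_surjective p -> (forall x, p x = 0 <-> I x) ->
  phi_torsion T.
Proof.
move=> nI surp kerp x; exists I; split=> // a Ia.
have [y _ <-] : range p x by rewrite surp.
rewrite -linearZ; apply/kerp; have [[_ _ IM] _] := nI.
by rewrite [_ *: _]mulrC; exact: IM.
Qed.

(** The presentation is [R^n -> R -> R/I], with [R] as row vectors of length one. *)
Lemma cyclic_finitely_presented I (T : lmodType R) (p : {linear R^o -> T}) :
  fin_gen_ideal I -> lin_surjective p -> (forall x, p x = 0 <-> I x) ->
  finitely_presented T.
Proof.
move=> [n [a ->]] surp kerp.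
have [|f fE] := @linear_pack R 'rV[R]_n 'rV[R]_1 (fun v => v *m \col_i a i).
  by move=> b v w; rewrite mulmxDl scalemxAl.
have [|g gE] := @linear_pack R 'rV[R]_1 T (fun v => p (v 0 0)).
  by move=> b v w; rewrite !mxE -linearP.
exists n, 1%N, f, g; split.
  apply/seteqP; split=> [_ [v _ <-]|v] /=; rewrite gE.
    rewrite fE; apply/kerp; exists (fun i => v 0 i); rewrite mxE.
    by apply: eq_bigr => i _; rewrite mxE.
  move=> /kerp[c vE]; exists (\row_i c i) => //; rewrite fE.
  apply/rowP => j; rewrite ord1 vE mxE.
  by apply: eq_bigr => i _; rewrite !mxE.
apply/seteqP; split=> // x _; have [y _ <-] : range p x by rewrite surp.
by exists (const_mx y) => //; rewrite gE mxE.
Qed.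

(** Baer's criterion relative to phi-torsion modules, applied to the kernel of the free cover. *)
Lemma extends_nonnil_injective M :
  (forall I, nonnil_ideal I -> extends_ideal I M) -> nonnil_injective M.
Proof.
move=> extM T torT.
apply/(Ext1_eq0P _ (@free_projective R T) (@free_cover_surjective R T)).
move: (free_cover T) => p h h_lin.
pose G : set (free_mod T * M) := [set u | p u.1 = 0 /\ u.2 = h u.1].
have [||x I idI GI|f fP] := @linear_graph_extends R (free_mod T) M G.
- split=> [|a [x c] [y d] [/= px ->] [/= py ->]].
    by split; rewrite ?linear0 ?(linear_on_kernel0 h_lin).
  by split; rewrite /= ?h_lin // linearP px py scaler0 addr0.
- by move=> m [_ /= ->]; exact: linear_on_kernel0 h_lin.
(* [J] kills [p x], so its elements carry [x] into the kernel of [p], which is the domain of [G].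
   Hence [I] contains the non-nilpotent [s] of [J]. *)
- apply: extM; split=> //; have [J [[_ [s [Js nils]]] Jx]] := torT (p x).
  exists s; split=> //; apply: GI; exists (h (s *: x)).
  by split; rewrite ?linearZ_LR ?Jx.
by exists f => x px; apply: fP.
Qed.

(** For a nonnil [I], the module [R/I] is phi-torsion and finitely presented, so maps from [I] to
    [M] extend. *)
Lemma nonnil_Noetherian_injective M :
  nonnil_Noetherian R -> nonnil_FP_injective M -> nonnil_injective M.
Proof.
move=> noethR fpM; apply: extends_nonnil_injective => I nI.
have [Q [p [surp kerp]]] := quotient_exists (ideal_submod (proj1 nI)).
apply/(Ext1_eq0_ideal _ surp kerp); apply: fpM.
  exact: cyclic_finitely_presented (noethR _ nI) surp kerp.
exact: cyclic_phi_torsion nI surp kerp.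
Qed.

Definition add_generator I (x : R) : set R :=
  [set y | exists i r, I i /\ y = i + r * x].

Lemma fin_gen_add_generator I x :
  fin_gen_ideal I -> fin_gen_ideal (add_generator I x).
Proof.
move=> [n [a ->]].
(* The new generator takes index [0], and the old ones move up by one. *)
exists n.+1, (fun i => if unlift ord0 i is Some j then a j else x).
apply/seteqP; split=> [_ [_ [r [[c ->] ->]]]|y [c ->]].
  exists (fun i => if unlift ord0 i is Some j then c j else r).
  rewrite big_ord_recl unlift_none addrC; congr (_ + _).
  by apply: eq_bigr => i _; rewrite liftK.
exists (\sum_i c (lift ord0 i) * a i), (c ord0).
split; first by exists (fun i => c (lift ord0 i)).
rewrite big_ord_recl unlift_none addrC; congr (_ + _).
by apply: eq_bigr => i _; rewrite liftK.
Qed.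

Lemma fin_gen_is_ideal I : fin_gen_ideal I -> is_ideal I.
Proof.
move=> [n [a ->]]; split=> [|_ _ [c ->] [d ->]|b _ [c ->]].
- by exists (fun=> 0); rewrite big1 // => i _; rewrite mul0r.
- exists (fun i => c i + d i); rewrite -big_split.
  by apply: eq_bigr => i _; rewrite mulrDl.
- exists (fun i => b * c i); rewrite mulr_sumr.
  by apply: eq_bigr => i _; rewrite mulrA.
Qed.

(** Start from the ideal generated by a non-nilpotent [s] of [I] and keep adjoining a point of [I]
    outside the current ideal, which is finitely generated and so never all of [I]. *)
Lemma not_fin_gen_chain I : nonnil_ideal I -> ~ fin_gen_ideal I ->
  exists (J : nat -> set R) (x : nat -> R),
    (exists2 s, J 0%N s & ~ Nil s) /\
    forall n, [/\ is_ideal (J n), J n `<=` J n.+1, J n.+1 (x n) & ~ J n (x n)].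
Proof.
move=> [idI [s [Is nils]]] nfgI; have [I0 ID IM] := idI.
(* [e K] is the point to adjoin to [K]; the value [0] fills in for any [K] that is not finitely
   generated or not inside [I]. *)
have /choice[e eP] (K : set R) : exists x,
    fin_gen_ideal K -> K `<=` I -> I x /\ ~ K x.
  have [fgK|] := pselect (fin_gen_ideal K); last by exists 0.
  have [KI|] := pselect (K `<=` I); last by exists 0.
  have /existsNP[x /not_implyP[Ix nKx]] : ~ I `<=` K.
    by move=> IK; apply: nfgI; rewrite (_ : I = K) //; apply/seteqP.
  by exists x.
pose J n := iter n (fun K => add_generator K (e K)) (add_generator [set 0] s).
have JP n : fin_gen_ideal (J n) /\ J n `<=` I.
  elim: n => [|n [fgJ JI]].
    split; last by move=> _ [_ [r [-> ->]]]; rewrite add0r; exact: IM.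
    apply: fin_gen_add_generator; exists 0%N, (fun=> 0).
    apply/seteqP; split=> [_ ->|_ [c ->]]; rewrite ?big_ord0 //.
    by exists (fun=> 0); rewrite big_ord0.
  split; first exact: fin_gen_add_generator.
  move=> _ [y [r [Jy ->]]]; apply: ID; first exact: JI.
  by apply: IM; have [] := eP _ fgJ JI.
exists J, (fun n => e (J n)); split.
  by exists s => //; exists 0, 1; rewrite mul1r add0r.
move=> n; have [fgJ JI] := JP n; have [_ nJe] := eP _ fgJ JI.
have idJ := fin_gen_is_ideal fgJ; have [J0 _ _] := idJ.
split=> // [y Jy|]; first by exists y, 0; rewrite mul0r addr0.
by exists 0, 1; rewrite mul1r add0r.
Qed.

Lemma injective_nonnil_Noetherian :
  (forall M, nonnil_FP_injective M -> nonnil_injective M) ->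
  nonnil_Noetherian R.
Proof.
move=> injR I nI; apply: contrapT => nfgI.
have [J [x [[s J0s nils] JP]]] := not_fin_gen_chain nI nfgI.
have [D [divD cogD]] := divisible_cogenerator_exists.
have Jle m n : (m <= n)%N -> J m `<=` J n.
  move=> /subnK <-; elim: (n - m)%N => [//|k IH].
  by apply: subset_trans IH _; have [] := JP (k + m)%N.
pose K : set R := \bigcup_n J n.
have idK : is_ideal K.
  split=> [|y z [m _ Jy] [n _ Jz]|a y [m _ Jy]].
  - by exists 0%N => //; have [[]] := JP 0%N.
  - exists (maxn m n) => //; have [[_ JD _] _ _ _] := JP (maxn m n).
    apply: JD; first by apply: Jle Jy; exact: leq_maxl.
    by apply: Jle Jz; exact: leq_maxr.
  - by exists m => //; have [[_ _ JM] _ _ _] := JP m; exact: JM.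
have nK : nonnil_ideal K by split=> //; exists s; split=> //; exists 0%N.
have /choice[phi phiP] n : exists f : R -> D, [/\ {morph f : y z / y + z},
    forall y, J n y -> f y = 0 & f (x n) <> 0].
  have [[J0 JD JM] _ _ nJx] := JP n.
  apply: separating_character => // y z Jy Jz; apply: JD => //.
  by rewrite -mulN1r; apply: JM.
pose M := cofree_sum R D.
have [Q [p [surp kerp]]] := quotient_exists (ideal_submod idK).
(* [M] is nonnil-FP-injective, so the assumption [injR] makes [Ext^1(R/K, M)] vanish. *)
have extK : extends_ideal K M.
  apply/(Ext1_eq0_ideal _ surp kerp); apply: injR.
    by move=> T fpT _; exact: cofree_sum_Ext1_eq0.
  exact: cyclic_phi_torsion nK surp kerp.
(* For [y] in [J m], the components from [m] on vanish, which places [h y] in the direct sum; off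
   [K] the value may be [0]. *)
have /choice[h hP] y : exists f : M, K y -> val f = fun n r => phi n (r * y).
  have [[m _ Jmy]|nKy] := pselect (K y); last by exists 0.
  have [||f fE] := @cofree_sum_ex R D (fun n r => phi n (r * y));
    last by exists f.
    by move=> n r t; have [phiD _ _] := phiP n; rewrite mulrDl phiD.
  exists m => n mn; apply/funext => r; have [_ phi0 _] := phiP n.
  by have [[_ _ JM] _ _ _] := JP n; apply/phi0/JM; exact: Jle Jmy.
have [a y z Ky Kz|f fP] := extK h.
  apply/val_inj/funext => n; apply/funext => r.
  have [K0 KD KM] := idK; have [phiD _ _] := phiP n.
  rewrite cofree_sumDE cofree_sumZE !hP //; first by rewrite mulrDr phiD mulrA.
  by apply: KD => //; exact: KM.
(* Take [N] past the support of [f]. Component [N] of [h (x N)] at [1] is [phi N (x N)], which is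
   nonzero, while that of [x N *: f] is zero. *)
have [N fN] := cofree_sum_eventually0 f.
have [_ _ JxN _] := JP N; have KxN : K (x N) by exists N.+1.
have [_ _ []] := phiP N.
have : val (h (x N)) N 1 = val (x N *: f) N 1 by rewrite fP.
by rewrite cofree_sumZE hP // mul1r fN.
Qed.

End Nonnil.

Theorem proposition1p8 (R : comNzRingType) (hR : phi_ring R) :
  nonnil_Noetherian R <->
  (forall M : lmodType R, nonnil_FP_injective M -> nonnil_injective M).
Proof.
split=> [noethR M|]; first exact: nonnil_Noetherian_injective.
exact: injective_nonnil_Noetherian.
Qed.
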